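(* Let $n\ge 2$. The balanced elements of $G(\infty,\infty,n)$ that are of maximal length (that is, whose length $\ell$ is the maximum of $\ell$ over $G(\infty,\infty,n)$) are precisely the elements $\lambda^k$ with $k\in\mathbb{Z}\setminus\{0\}$. For $k\in\mathbb{Z}\setminus\{0\}$, the interval $[1,\lambda^k]$ is characterized as follows: for $w\in G(\infty,\infty,n)$, one has $w\preceq\lambda^k$ if and only if, for all $[j,d]\in Z'(w)$, the entry $w[j,d]$ is either $0$, $1$, or $x^k$.
   Context: Let $x$ be a transcendental parameter. $G(\infty,\infty,n)$ is the group of $n\times n$ monomial matrices (exactly one nonzero entry in each row and column) all of whose nonzero entries are of the form $x^m$, $m\in\mathbb{Z}$, with product of all nonzero entries equal to $1$. For a matrix $w$, $w[i,c]$ denotes its entry in row $i$ and column $c$. Generating set: $X=\{t_i\ (i\in\mathbb{Z}),\, s_3,\dots,s_n\}$, where $t_i$ is the block diagonal matrix with upper left $2\times2$ block $\begin{pmatrix}0 & x^{-i} \\ x^i & 0\end{pmatrix}$ and lower right block $I_{n-2}$, and $s_j$ ($3\le j\le n$) is the permutation matrix of the transposition $(j-1,j)$. All elements of $X$ are involutions and $X$ generates the group. For $w\in G(\infty,\infty,n)$, $\ell(w)$ is the minimal length of a word in elements of $X$ representing $w$. Partial orders: $v\preceq w$ if $\ell(v)+\ell(v^{-1}w)=\ell(w)$, and $v\preceq_r w$ if $\ell(wv^{-1})+\ell(v)=\ell(w)$. Intervals: $[1,w]=\{v : v\preceq w\}$ and $[1,w]_r=\{v : v\preceq_r w\}$.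 An element $w$ is balanced if $[1,w]=[1,w]_r$. $\lambda$ denotes the diagonal matrix $\mathrm{diag}(x^{-(n-1)},x,\dots,x)\in G(\infty,\infty,n)$. For $w\in G(\infty,\infty,n)$, a matrix index $[i,c]$ is a bubble if $w[j,d]=0$ for all $[j,d]\neq[i,c]$ with $j\le i$ and $d\le c$. Let $Z(w)=\{[j,d] : j\le i \text{ and } d\le c \text{ for some bubble } [i,c]\}$, and let $Z'(w)$ be the set of matrix indices not in $Z(w)$. *)

(* Defs.v *)
From mathcomp Require Import all_boot all_order all_algebra.
From mathcomp Require Import boolp classical_sets.

Set Implicit Arguments.
Unset Strict Implicit.
Unset Printing Implicit Defensive.

Import GRing.Theory.
Local Open Scope ring_scope.
Local Open Scope classical_set_scope.

(* All matrices have size n.+2, so that sizes range over the integers >= 2 and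
   the matrices form a unit ring, with integer powers.  Rows and columns are
   numbered from 0. *)

Section Defs.
Variables (L : fieldType) (x : L) (n : nat).
Implicit Types v w : 'M[L]_n.+2.

Definition monomial w : Prop :=
  (forall i, exists! j, w i j != 0) /\ (forall j, exists! i, w i j != 0).

(* The group G(oo, oo, n.+2). *)
Definition Ginf : set 'M[L]_n.+2 := [set w | [/\ monomial w,
  forall i j, w i j != 0 -> exists m : int, w i j = x ^ m &
  \prod_i \prod_(j | w i j != 0) w i j = 1]].

Definition tmx (i : int) : 'M[L]_n.+2 := \matrix_(a, b)
  if (a == 0%N :> nat) && (b == 1%N :> nat) then x ^ (- i)
  else if (a == 1%N :> nat) && (b == 0%N :> nat) then x ^ i
  else if (a == b) && (2 <= a)%N then 1 else 0.

(* The transposition of the 0-based positions j1 and j2 = j1 + 1 is (j-1, j)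
   with j = j2 + 1, so that 2 <= j2 says 3 <= j. *)
Definition generators : set 'M[L]_n.+2 :=
  [set g | (exists i : int, g = tmx i) \/
           (exists j1 j2 : 'I_n.+2,
              [/\ j2 = j1.+1 :> nat, (2 <= j2)%N & g = tperm_mx j1 j2])].

Definition word_for (k : nat) w : Prop := exists s : seq 'M[L]_n.+2,
  [/\ size s = k, forall g, g \in s -> generators g & \prod_(g <- s) g = w].

(* Minimal length of a word; the value 0 is junk when no word represents w,
   which does not happen for w in Ginf. *)
Definition len w : nat :=
  if pselect (exists k, `[< word_for k w >]) is left e then ex_minn e else 0%N.

Definition preceq v w : Prop := (len v + len (v^-1 * w)%R = len w)%N.
Definition preceq_r v w : Prop := (len (w * v^-1)%R + len v = len w)%N.

Definition interval w : set 'M[L]_n.+2 := [set v | Ginf v /\ preceq v w].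
Definition interval_r w : set 'M[L]_n.+2 := [set v | Ginf v /\ preceq_r v w].

Definition balanced w : Prop := interval w = interval_r w.

Definition maximal_length w : Prop := forall v, Ginf v -> (len v <= len w)%N.

Definition lam : 'M[L]_n.+2 :=
  diag_mx (\row_j if j == 0 then x ^ (- n.+1%:Z) else x).

(* The entry w i c itself is unconstrained: it may be zero. *)
Definition bubble w (i c : 'I_n.+2) : Prop :=
  forall j d : 'I_n.+2, (j, d) <> (i, c) -> (j <= i)%N -> (d <= c)%N ->
    w j d = 0.

Definition Zset w : set ('I_n.+2 * 'I_n.+2) :=
  [set p : 'I_n.+2 * 'I_n.+2 | exists i c : 'I_n.+2,
     [/\ bubble w i c, (p.1 <= i)%N & (p.2 <= c)%N]].

Definition Zset' w : set ('I_n.+2 * 'I_n.+2) := ~` Zset w.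

End Defs.

Arguments lam {L} x n.

(* Main.v *)
Require Import Defs.
From mathcomp Require Import all_boot all_order all_fingroup all_algebra.
From mathcomp Require Import boolp classical_sets.
From mathcomp Require Import zify.

Set Implicit Arguments.
Unset Strict Implicit.
Unset Printing Implicit Defensive.

Import GRing.Theory.
Local Open Scope ring_scope.
Local Open Scope classical_set_scope.

(** Write an element of the group as a permutation s together with integer
    exponents m of sum zero: row i holds x ^ m i in column s i.  The length has
    a closed form, a sum over the pairs of rows j < i: a pair with s i < s j
    (an inversion) counts 1, a pair with s j < s i counts 2 if m i is nonzero
    and 0 otherwise.

    This formula, [formlen], is the length for the usual two reasons.  Left
    multiplication by a generator exchanges two adjacent rows and changes
    exponents only in rows 0 and 1, which affects the weight of a single pair
    and moves it by one ([formlen_swap1]); so every word for w has at least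
    [formlen] letters ([word_formlen]).  Conversely every element other than 1
    has a generator that lowers [formlen] ([gmx_descent]).

    Let w be diagonal with exponents d, nonzero outside row 0.  These are the
    elements of maximal length, since exactly for them all pairs weigh 2
    ([formlen_max]).  For v = (s, m), the product w^-1 v has the same
    permutation s and exponents m - d, and v w^-1 has s and m - d \o s.
    A length does not change under inversion, so v is below w for either
    order when two sums over the same pairs add up to the bound 2 on each
    pair, and the comparison is made pair by pair ([formlen_shift]): the
    condition is that m i be 0 or d i, respectively 0 or d (s i), whenever
    some j < i has s j < s i.

    The two intervals therefore agree when d is constant outside row 0, and
    a transposition of two rows i, k with exponent d i placed in row i separates
    them when d i and d k differ ([balanced_diag]).  As the exponents add
    up to zero, this leaves exactly the powers of lambda.  Finally the rows i
    which have some j < i with s j < s i are those whose nonzero entry lies in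
    Z' ([Zset'P]), which gives the description of the interval. *)

(** * The length formula on permutations with exponents *)

Section Weights.
Variable N : nat.
Implicit Types (s : 'S_N) (m e : 'I_N -> int) (a b i j : 'I_N).

(** The contribution to the length of the nonzero entries of rows j < i of the
    monomial matrix whose row i holds x ^ m i in column s i. *)
Definition pairwt s m j i : nat :=
  if (s i < s j)%N then 1 else if m i == 0 then 0 else 2.

Definition formlen s m : nat :=
  (\sum_(p : 'I_N * 'I_N | (p.1 < p.2)%N) pairwt s m p.1 p.2)%N.

Definition formlen_bound : nat := (\sum_(p : 'I_N * 'I_N | (p.1 < p.2)%N) 2)%N.

Lemma pairwt_le2 s m j i : (pairwt s m j i <= 2)%N.
Proof. by rewrite /pairwt; case: ifP => // _; case: ifP. Qed.

Lemma formlen_le s m : (formlen s m <= formlen_bound)%N.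
Proof. by apply: leq_sum => p _; apply: pairwt_le2. Qed.

Lemma perm_ltnNge s i j : (i < j)%N -> (s j < s i)%N = ~~ (s i < s j)%N.
Proof.
move=> ij; have : (s i != s j) by rewrite (inj_eq perm_inj) neq_ltn ij.
by rewrite neq_ltn; case: ltngtP.
Qed.

Lemma tperm_adj a b i j : b = a.+1 :> nat ->
  ((tperm a b i < tperm a b j)%N && ((tperm a b i, tperm a b j) != (a, b)))
  = ((i < j)%N && ((i, j) != (a, b))).
Proof.
move=> ba; rewrite !xpair_eqE -!(inj_eq val_inj) /=.
case: tpermP => [->|->|/eqP + /eqP]; case: tpermP => [->|->|/eqP + /eqP];
  rewrite -?(inj_eq val_inj) /=; lia.
Qed.

(** Exchanging two adjacent rows keeps the relative order of all pairs of rows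
    but that one.  The exponents may change at i as long as i is the lower row
    of no other pair, because only the lower exponent of a pair is counted. *)
Lemma formlen_swap s s' m m' a b : b = a.+1 :> nat ->
  s' = (tperm a b * s)%g ->
  (forall j i, (j < i)%N -> (j, i) != (a, b) -> m' i = m (tperm a b i)) ->
  (formlen s' m' + pairwt s m a b = formlen s m + pairwt s' m' a b)%N.
Proof.
move=> ba -> m'E; have ab : (a < b)%N by rewrite ba.
rewrite /formlen (bigD1 (a, b)) //= [in RHS](bigD1 (a, b)) //=.
rewrite -addnA [RHS]addnC; congr addn.
rewrite addnC; congr addn.
pose h (p : 'I_N * 'I_N) := (tperm a b p.1, tperm a b p.2).
have hinj : injective h by move=> [? ?] [? ?] [] /perm_inj-> /perm_inj->.
rewrite [RHS](reindex_inj hinj) /=.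
apply: eq_big => [[j i]|[j i] /andP[/= ji jiab]]; first by rewrite /= tperm_adj.
by rewrite /pairwt (m'E j i ji jiab) !permM.
Qed.

(** Adjacent exchange turns an inverted pair, of weight 1, into a non-inverted
    one, of weight 0 or 2, and conversely. *)
Lemma formlen_swap1 s s' m m' a b : b = a.+1 :> nat ->
  s' = (tperm a b * s)%g ->
  (forall j i, (j < i)%N -> (j, i) != (a, b) -> m' i = m (tperm a b i)) ->
  formlen s' m' = (formlen s m).+1 \/ formlen s m = (formlen s' m').+1.
Proof.
move=> ba s'E m'E; have := formlen_swap ba s'E m'E.
have ab : (a < b)%N by rewrite ba.
rewrite /pairwt s'E !permM tpermL tpermR (perm_ltnNge s ab).
by case: (s a < s b)%N => /=; case: ifP => _; lia.
Qed.

Lemma perm_adj_mono s :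
  (forall a b, b = a.+1 :> nat -> (s a < s b)%N) -> s = 1%g.
Proof.
move=> smono.
have le_s i : (i <= s i)%N.
  case: i => k; elim: k => [//|k IH] kN.
  by apply: leq_ltn_trans (IH (ltnW kN)) (smono (Ordinal (ltnW kN)) _ _).
(* The values s i and the indices i have the same sum. *)
have /leqif_sum : forall i, true -> (i <= s i ?= iff (i == s i :> nat))%N.
  by move=> i _; split.
case=> _; rewrite [X in _ == X](reindex_inj (perm_inj (s := s^-1%g))).
under [X in _ == X]eq_bigr do rewrite permKV.
rewrite eqxx => /esym/forallP s1; apply/permP => i.
by rewrite perm1; apply/val_inj/esym/eqP/(s1 i).
Qed.

Lemma adj_pairwt0 s m :
  (forall a b, b = a.+1 :> nat -> pairwt s m a b = 0%N) ->
  s = 1%g /\ forall a b, b = a.+1 :> nat -> m b = 0.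
Proof.
move=> wt0; split.
  apply: perm_adj_mono => a b ba; have ab : (a < b)%N by rewrite ba.
  have := wt0 a b ba; rewrite /pairwt (perm_ltnNge s ab).
  by case: ltnP.
move=> a b ba; have := wt0 a b ba; rewrite /pairwt.
by case: ifP => //; case: eqP.
Qed.

(** Both lengths run over the same permutation, so they can be compared pair by
    pair: an inverted pair contributes 1 + 1, and a non-inverted one 0, 2 or
    4 in total, where 0 is excluded because m i and m i - e i do not vanish
    together when e i is nonzero.  Hence the total is at least 2 on every pair,
    and it equals the bound exactly when no pair contributes 4. *)
Lemma formlen_shift s m e :
  (forall j i, (j < i)%N -> (s j < s i)%N -> e i != 0) ->
  (formlen s m + formlen s (fun i => (m i - e i)%R) =
     formlen_bound)%N <->
  (forall j i, (j < i)%N -> (s j < s i)%N -> m i = 0 \/ m i = e i).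
Proof.
move=> e0; rewrite /formlen_bound /formlen -big_split /=.
pose F (q : 'I_N * 'I_N) := (pairwt s m q.1 q.2 + pairwt s (fun i => (m i - e i)%R) q.1 q.2)%N.
have FE j i : (s j < s i)%N -> F (j, i) = ((m i != 0).*2 + (m i != e i).*2)%N.
  move=> sji; rewrite /F /pairwt /= subr_eq0 ltnNge (ltnW sji) /=.
  by do 2 case: eqP.
have F2 j i : (j < i)%N -> (s i < s j)%N -> F (j, i) = 2%N.
  by move=> ji sij; rewrite /F /pairwt /= sij.
have /leqif_sum[_ FS] (q : 'I_N * 'I_N) : (q.1 < q.2)%N -> (2 <= F q ?= iff (F q == 2%N))%N.
  case: q => j i /= ji; split; last by rewrite eq_sym.
  have [sij|sij] := boolP (s i < s j)%N; first by rewrite F2.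
  have sji : (s j < s i)%N by rewrite (perm_ltnNge s ji) in sij; exact: negbNE.
  rewrite FE //; case: eqP => // ->.
  by rewrite eq_sym (e0 j i).
split=> [FS2 j i ji sji|mE].
  move: FS; rewrite -[X in _ == X]/(\sum_(q : 'I_N * 'I_N | (q.1 < q.2)%N) F q)%N FS2 eqxx.
  move=> /esym/forallP/(_ (j, i)); rewrite /= ji FE //=.
  have [->|_] := eqVneq (m i) 0; first by left.
  by have [->|_] := eqVneq (m i) (e i); first by right.
apply/esym/eqP; rewrite FS; apply/forallP => -[j i]; apply/implyP => /= ji.
have [sij|sij] := boolP (s i < s j)%N; first by rewrite F2.
have sji : (s j < s i)%N by rewrite (perm_ltnNge s ji) in sij; exact: negbNE.
have ei := e0 j i ji sji.
rewrite FE //; case: (mE j i ji sji) => ->; last by rewrite ei eqxx.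
by rewrite eqxx (eq_sym 0) ei.
Qed.

End Weights.

(** * Monomial matrices as permutations with exponents *)

Section Monomial.
Variables (L : fieldType) (x : L) (n : nat).
Local Notation I := 'I_n.+2.
Implicit Types (s t : {perm I}) (m p d e : I -> int) (w : 'M[L]_n.+2) (i j a b : I).
Hypothesis x0 : x != 0.
Hypothesis xinf : forall k : int, x ^ k = 1 -> k = 0.

Lemma exprz_inj (k l : int) : x ^ k = x ^ l -> k = l.
Proof.
move=> kl; apply/eqP; rewrite -subr_eq0; apply/eqP/xinf.
by rewrite expfzDr // kl -expfzDr // subrr.
Qed.

Lemma prod_exprz m : \prod_i x ^ m i = x ^ (\sum_i m i).
Proof.
by apply/esym; apply: (big_morph (fun k => x ^ k)) => // k l; rewrite expfzDr.
Qed.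

Definition gmx s m : 'M[L]_n.+2 := \matrix_(i, j) if j == s i then x ^ m i else 0.

Lemma gmx_neq0 s m i j : (gmx s m i j != 0) = (j == s i).
Proof. by rewrite mxE; case: (j =P s i); rewrite ?eqxx ?expfz_neq0. Qed.

Lemma gmxE s m i : gmx s m i (s i) = x ^ m i.
Proof. by rewrite mxE eqxx. Qed.

Lemma eq_gmx s m p : m =1 p -> gmx s m = gmx s p.
Proof. by move=> mp; apply/matrixP => i j; rewrite !mxE mp. Qed.

Lemma gmx_inj s t m p : gmx s m = gmx t p -> s = t /\ m =1 p.
Proof.
move=> e; have st : s = t.
  by apply/permP => i; apply/eqP; rewrite -(gmx_neq0 t p) -e gmx_neq0.
split=> // i; apply: exprz_inj; by rewrite -(gmxE s) e st gmxE.
Qed.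

Lemma gmx1 : gmx 1 (fun=> 0) = 1.
Proof. by apply/matrixP => i j; rewrite !mxE perm1 eq_sym; case: eqP. Qed.

Lemma gmxM s t m p :
  gmx s m * gmx t p = gmx (s * t) (fun i => m i + p (s i)).
Proof.
apply/matrixP => i j; rewrite !mxE (bigD1 (s i)) //= big1 => [|k /negPf ki].
  by rewrite !mxE eqxx addr0 permM; case: eqP; rewrite ?mulr0 ?expfzDr.
by rewrite !mxE ki mul0r.
Qed.

Lemma gmxKV s m : gmx s m * gmx s^-1 (fun i => - m (s^-1%g i)) = 1.
Proof.
by rewrite gmxM mulgV -gmx1; apply: eq_gmx => i; rewrite permK subrr.
Qed.

Lemma gmx_unit s m : gmx s m \is a GRing.unit.
Proof. by case/mulmx1_unit: (gmxKV s m). Qed.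

Lemma gmxV s m : (gmx s m)^-1 = gmx s^-1 (fun i => - m (s^-1%g i)).
Proof. by rewrite -[RHS](mulKr (gmx_unit s m)) gmxKV mulr1. Qed.

Lemma GinfP w :
  Ginf x w <-> exists s m, w = gmx s m /\ \sum_i m i = 0.
Proof.
split=> [[[rows cols] ent prd]|[s [m [-> m0]]]].
  pose f i : {j | w i j != 0} :=
    cid (let: ex_intro j (conj h _) := rows i in ex_intro _ j h).
  have finj : injective (fun i => sval (f i)).
    move=> i k e; have [r [_ ru]] := cols (sval (f i)).
    rewrite -(ru i (svalP (f i))) (ru k) //.
    by move: (svalP (f k)); rewrite -e.
  pose m i := sval (cid (ent i _ (svalP (f i)))).
  have mE i : w i (sval (f i)) = x ^ m i.
    exact: (svalP (cid (ent i _ (svalP (f i))))).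
  have wE : w = gmx (perm finj) m.
    apply/matrixP => i j; rewrite mxE permE; case: eqP => [->|jf]; first exact: mE.
    apply/eqP/negPn/negP => wij; apply: jf.
    by have [r [_ ru]] := rows i; rewrite -(ru _ wij) (ru _ (svalP (f i))).
  exists (perm finj), m; split=> //; apply: xinf; rewrite -prod_exprz -[RHS]prd.
  apply: eq_bigr => i _; rewrite wE.
  under eq_bigl do rewrite gmx_neq0.
  by rewrite big_pred1_eq gmxE.
split.
- split=> [i|j].
    exists (s i); split=> [|j]; rewrite gmx_neq0 ?eqxx //.
    by move=> /eqP.
  exists (s^-1%g j); split=> [|i]; rewrite gmx_neq0 ?permKV //.
  by move=> /eqP ->; rewrite permK.
- by move=> i j; rewrite gmx_neq0 => /eqP->; exists (m i); rewrite gmxE.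
rewrite -[RHS](expr0z x) -m0 -prod_exprz; apply: eq_bigr => i _.
under eq_bigl do rewrite gmx_neq0.
by rewrite big_pred1_eq gmxE.
Qed.

(** With the transposition of a and b these are the exponents of t_k for
    (a, b) = (0, 1), and those of a permutation matrix for k = 0. *)
Definition genexp a b (k : int) i : int :=
  if i == a then - k else if i == b then k else 0.

Lemma genexp0 a b i : genexp a b 0 i = 0.
Proof. by rewrite /genexp oppr0 !if_same. Qed.

Lemma sum_genexp a b k : a != b -> \sum_i genexp a b k i = 0.
Proof.
move=> ab; rewrite (bigD1 a) //= (bigD1 b) ?(eq_sym b) //= /genexp eqxx.
rewrite eq_sym (negPf ab) eqxx big1 ?addr0 ?addNr // => i /andP[].
by move=> /negPf-> /negPf->.
Qed.

Lemma generatorsP w :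
  generators x w <->
  exists a b k, [/\ b = a.+1 :> nat, a != 0%N :> nat -> k = 0 &
                    w = gmx (tperm a b) (genexp a b k)].
Proof.
have tmxE k : tmx x n k = gmx (tperm ord0 (Ordinal (isT : 1 < n.+2)%N))
                 (genexp ord0 (Ordinal (isT : 1 < n.+2)%N) k).
  apply/matrixP => i j; rewrite !mxE /genexp -!(inj_eq val_inj) /=.
  case: tpermP => [->|->|/eqP + /eqP]; rewrite -?(inj_eq val_inj) /=.
  - by rewrite andbF; case: eqP.
  - by rewrite andbF; case: eqP.
  move=> i0 i1; rewrite (negPf i0) (negPf i1) /= eq_sym expr0z.
  by case: eqP => //= _; case: ltngtP => //; lia.
have tpmE a b : tperm_mx a b = gmx (tperm a b) (genexp a b 0).
  apply/matrixP => i j; rewrite !mxE genexp0 expr0z eq_sym.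
  by case: eqP.
split=> [[[k ->]|[a [b [ba b2 ->]]]]|[a [b [k [ba k0 ->]]]]].
- by exists ord0, (Ordinal (isT : 1 < n.+2)%N), k; rewrite tmxE.
- by exists a, b, 0; split.
have [a0|a0] := eqVneq (a : nat) 0%N.
  left; exists k; rewrite tmxE; have -> : a = ord0 by exact: val_inj.
  by have -> : b = Ordinal (isT : 1 < n.+2)%N by apply: val_inj; rewrite /= ba a0.
by right; exists a, b; split=> //; [lia|rewrite k0 // tpmE].
Qed.

Lemma genmx_invol a b k : b = a.+1 :> nat ->
  gmx (tperm a b) (genexp a b k) * gmx (tperm a b) (genexp a b k) = 1.
Proof.
move=> ba; rewrite gmxM tperm2 -gmx1; apply: eq_gmx => i.
have e1 : (a.+1 == a :> nat) = false by lia.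
rewrite /genexp -!(inj_eq val_inj) /=.
case: tpermP => [->|->|/eqP + /eqP]; rewrite -?(inj_eq val_inj) /= ba.
- by rewrite !eqxx e1 addNr.
- by rewrite !eqxx e1 subrr.
by move=> /negPf-> /negPf->.
Qed.

(** A nonzero exponent of a generator sits in row 0 or 1, and row 1 is the lower
    row of the pair (0, 1) only: this is the condition of [formlen_swap]. *)
Lemma genexp_far a b k i j : b = a.+1 :> nat -> (a != 0%N :> nat -> k = 0) ->
  (j < i)%N -> (j, i) != (a, b) -> genexp a b k i = 0.
Proof.
move=> ba k0 ji; have [a0|/k0-> _] := eqVneq (a : nat) 0%N; last exact: genexp0.
rewrite xpair_eqE /genexp -!(inj_eq val_inj) /=.
move=> jiab; case: ifP => [|_]; first lia.
by case: ifP => //; lia.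
Qed.

(** * The length *)

Lemma sum_perm s m : \sum_i m (s i) = \sum_i m i.
Proof. by rewrite [RHS](reindex_inj (perm_inj (s := s))). Qed.

Lemma word_cons k g w :
  generators x g -> word_for x k w -> word_for x k.+1 (g * w).
Proof.
move=> gg [r [<- rg <-]]; exists (g :: r); split; rewrite ?big_cons // => h.
by rewrite inE => /orP[/eqP->//|/rg].
Qed.

Lemma formlen1 : formlen (1 : {perm I}) (fun=> 0) = 0%N.
Proof.
by rewrite /formlen big1 // => -[j i] /= ji; rewrite /pairwt !perm1 eqxx ltnNge ltnW.
Qed.

Lemma word_formlen k w : word_for x k w ->
  exists s m, [/\ w = gmx s m, \sum_i m i = 0 & (formlen s m <= k)%N].
Proof.
case=> r [<- + <-] {k w}; elim: r => [_|g r IH rg].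
  by exists 1%g, (fun=> 0); rewrite big_nil gmx1 big1 // formlen1.
have [|s [m [wE m0 le]]] := IH; first by move=> h hr; apply: rg; rewrite inE hr orbT.
have /generatorsP[a [b [k [ba k0 gE]]]] := rg g (mem_head _ _).
exists (tperm a b * s)%g, (fun i => genexp a b k i + m (tperm a b i)).
split; first by rewrite big_cons wE gE gmxM.
  rewrite big_split /= sum_perm m0 addr0 sum_genexp //.
  by rewrite -(inj_eq val_inj) /= ba; lia.
have := @formlen_swap1 _ s _ m (fun i => genexp a b k i + m (tperm a b i)) a b ba erefl.
case=> [j i ji jiab|->//=|/=]; last by move=> e; lia.
by rewrite (genexp_far ba k0 ji jiab) add0r.
Qed.

(** If b is the first row whose pair with the row above has nonzero weight,
    exchanging these rows helps.  A pair of weight 2 becomes an inversion.  An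
    inversion becomes a pair whose lower exponent is m a: it is 0 if a > 0,
    because the pair above has weight 0, and can be cancelled by the choice of
    t_k if a = 0. *)
Lemma descent s m a b : b = a.+1 :> nat -> pairwt s m a b != 0%N ->
  exists a b k, [/\ b = a.+1 :> nat, a != 0%N :> nat -> k = 0 &
   (pairwt (tperm a b * s)%g (fun i => genexp a b k i + m (tperm a b i))%R a b
     < pairwt s m a b)%N].
Proof.
elim: {b}(b : nat) {-2}b (erefl (b : nat)) a => [|c IH] b bc a ba wt; first lia.
have ab : (a < b)%N by rewrite ba.
have aNb : (b == a) = false by rewrite -(inj_eq val_inj) /= ba; lia.
have wtE k : pairwt (tperm a b * s) (fun i => genexp a b k i + m (tperm a b i)) a b =
    if (s b < s a)%N then if k + m a == 0 then 0%N else 2%N else 1%N.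
  rewrite /pairwt !permM tpermL tpermR /genexp eqxx aNb (perm_ltnNge s ab).
  by case: (s a < s b)%N.
have wt0 : pairwt s m a b = if (s b < s a)%N then 1%N else if m b == 0 then 0%N else 2%N by [].
have [inv|ninv] := boolP (s b < s a)%N; last first.
  exists a, b, 0; split=> //; rewrite wtE wt0 (negPf ninv).
  by move: wt; rewrite wt0 (negPf ninv); case: (m b == 0).
have [a0|a0] := eqVneq (a : nat) 0%N.
  exists a, b, (- m a); split=> //; first by rewrite a0.
  by rewrite wtE wt0 inv addNr eqxx.
have c1 : (c.-1 < n.+2)%N by have := ltn_ord a; lia.
have [wt1|wt1] := eqVneq (pairwt s m (Ordinal c1) a) 0%N; last first.
  by apply: IH wt1 => /=; lia.
have ma : m a = 0.
  by move: wt1; rewrite /pairwt; case: ifP => // _; case: eqP.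
by exists a, b, 0; split=> //; rewrite wtE wt0 inv ma eqxx.
Qed.

(** When all adjacent pairs weigh 0, the permutation is increasing and the
    exponents vanish outside row 0, hence also there since their sum is 0. *)
Lemma gmx_descent s m : \sum_i m i = 0 ->
  (s = 1%g /\ m =1 fun=> 0) \/
  exists g s' m', [/\ generators x g, gmx s m = g * gmx s' m',
    \sum_i m' i = 0 & formlen s m = (formlen s' m').+1].
Proof.
move=> m0.
have [[a [b [ba wt]]]|none] :=
  pselect (exists a b, b = a.+1 :> nat /\ pairwt s m a b != 0%N).
  right; have [{wt ba}a [{}b [c [ba c0 lt]]]] := descent ba wt.
  have ab : a != b by rewrite -(inj_eq val_inj) /= ba; lia.
  pose p i := genexp a b c i + m (tperm a b i).
  exists (gmx (tperm a b) (genexp a b c)), (tperm a b * s)%g, p; split.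
  - by apply/generatorsP; exists a, b, c.
  - by rewrite /p -gmxM mulrA genmx_invol // mul1r.
  - by rewrite /p big_split /= sum_perm m0 addr0 sum_genexp.
  have pE j i : (j < i)%N -> (j, i) != (a, b) -> p i = m (tperm a b i).
    by move=> ji /(genexp_far ba c0 ji); rewrite /p => ->; rewrite add0r.
  have {}lt : (pairwt (tperm a b * s)%g p a b < pairwt s m a b)%N := lt.
  have := formlen_swap (s := s) ba erefl pE.
  by have [] := formlen_swap1 (s := s) ba erefl pE; lia.
left; have [|-> mb] := @adj_pairwt0 _ s m.
  by move=> a b ba; apply/eqP/negPn/negP => wt; apply: none; exists a, b.
split=> // i; have m_pos j : j != ord0 -> m j = 0.
  rewrite -(inj_eq val_inj) /= => j0; have c : (j.-1 < n.+2)%N by have := ltn_ord j; lia.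
  by apply: (mb (Ordinal c)) => /=; lia.
have [->|/m_pos//] := eqVneq i ord0.
by move: m0; rewrite (bigD1 ord0) //= big1 ?addr0.
Qed.

Lemma formlen_word s m : \sum_i m i = 0 -> word_for x (formlen s m) (gmx s m).
Proof.
have [k] := ubnP (formlen s m); elim: k s m => // k IH s m sk m0.
have [[-> /funext->]|[g [s' [m' [gg -> m'0 sE]]]]] := gmx_descent s m0.
  by rewrite formlen1 gmx1; exists [::]; split=> //; rewrite big_nil.
by rewrite sE; apply: word_cons gg _; apply: IH; rewrite // -ltnS -sE.
Qed.

Lemma len_eq k w : word_for x k w ->
  (forall k', word_for x k' w -> (k <= k')%N) -> len x w = k.
Proof.
move=> wk mink; rewrite /len; case: pselect => [e|[]]; last by exists k; apply/asboolP.
case: ex_minnP => l /asboolP wl minl; apply/eqP; rewrite eqn_leq mink // andbT.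
by apply: minl; apply/asboolP.
Qed.

Lemma len_gmx s m : \sum_i m i = 0 -> len x (gmx s m) = formlen s m.
Proof.
move=> m0; apply: len_eq; first exact: formlen_word.
by move=> k /word_formlen[t [p [/gmx_inj[-> /funext->] _ le]]].
Qed.

Lemma word_for_unit k w : word_for x k w -> w \is a GRing.unit.
Proof. by case/word_formlen => s [m [-> _ _]]; apply: gmx_unit. Qed.

(** Generators are involutions, so that reversing a word inverts its value. *)
Lemma word_forV k w : word_for x k w -> word_for x k w^-1.
Proof.
case=> r [<- + <-] {k w}; elim: r => [_|g r IH rg].
  by exists [::]; rewrite big_nil invr1; split.
have rg' h : h \in r -> generators x h by move=> hr; apply: rg; rewrite inE hr orbT.
have [r' [sr' r'g r'E]] := IH rg'.
have gg := rg g (mem_head _ _).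
have [gU g2] : g \is a GRing.unit /\ g * g = 1.
  case/generatorsP: gg => [a [b [k [ba _ ->]]]].
  by split; [apply: gmx_unit|apply: genmx_invol].
have rU : \prod_(h <- r) h \is a GRing.unit by apply: (@word_for_unit (size r)); exists r.
exists (rcons r' g); split; first by rewrite !size_rcons sr'.
  by move=> h; rewrite mem_rcons inE => /orP[/eqP->//|/r'g].
rewrite big_cons -cats1 big_cat big_seq1 /= r'E invrM //.
by congr (_ * _); rewrite -[LHS](mulKr gU) g2 mulr1.
Qed.

Lemma len_gmxV s m : \sum_i m i = 0 -> len x (gmx s m)^-1 = formlen s m.
Proof.
move=> m0; apply: len_eq; first exact/word_forV/formlen_word.
move=> k /word_forV; rewrite invrK => /word_formlen[t [p [/gmx_inj[-> /funext->] _ le]]].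
exact: le.
Qed.


(** * Intervals below elements of maximal length *)

(** The exponents of the diagonal elements of maximal length. *)
Definition diagexp (d : I -> int) : Prop :=
  \sum_i d i = 0 /\ forall i, i != ord0 -> d i != 0.

Lemma lt_ord_neq0 (i j : I) : (j < i)%N -> i != ord0.
Proof. by rewrite -(inj_eq val_inj) /=; case: (i : nat). Qed.

Lemma formlen_max s m :
  (formlen s m = formlen_bound n.+2)%N <->
  s = 1%g /\ forall i, i != ord0 -> m i != 0.
Proof.
have /leqif_sum[_ S] (q : I * I) : (q.1 < q.2)%N ->
    (pairwt s m q.1 q.2 <= 2 ?= iff (pairwt s m q.1 q.2 == 2%N))%N.
  by move=> _; split; first exact: pairwt_le2.
rewrite (rwP eqP) [X in is_true X]S; split=> [/forallP w2|[-> m0]]; last first.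
  apply/forallP => -[j i]; apply/implyP => /= ji.
  by rewrite /pairwt !perm1 ltnNge ltnW //= (negPf (m0 i (lt_ord_neq0 ji))).
have {}w2 j i : (j < i)%N -> (s j < s i)%N /\ m i != 0.
  move=> ji; have := w2 (j, i); rewrite /= ji /pairwt (perm_ltnNge s ji).
  by case: (s j < s i)%N => //=; case: (m i == 0).
split; first by apply: perm_adj_mono => a b ba; case: (w2 a b); rewrite ?ba.
move=> i i0; case: (w2 ord0 i) => //.
by move: i0; rewrite -(inj_eq val_inj) /= lt0n.
Qed.

(** The length of v^-1 w is read off its inverse w^-1 v, whose permutation is
    that of v. *)
Lemma preceq_diag d s m : diagexp d -> \sum_i m i = 0 ->
  preceq x (gmx s m) (gmx 1 d) <->
  (forall j i, (j < i)%N -> (s j < s i)%N -> m i = 0 \/ m i = d i).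
Proof.
move=> [dS d0] mS; rewrite /preceq.
have -> : (gmx s m)^-1 * gmx 1 d = (gmx s (fun i => m i - d i))^-1.
  rewrite -[gmx 1 d]invrK -invrM ?unitrV ?gmx_unit // gmxV gmxM invg1 mul1g.
  by congr (_^-1); apply: eq_gmx => i; rewrite !perm1 addrC.
rewrite len_gmxV; last by rewrite sumrB mS dS subrr.
rewrite !len_gmx // ((formlen_max 1 d).2 (conj erefl d0)).
by apply: formlen_shift => j i /lt_ord_neq0/d0.
Qed.

Lemma preceq_r_diag d s m : diagexp d -> \sum_i m i = 0 ->
  preceq_r x (gmx s m) (gmx 1 d) <->
  (forall j i, (j < i)%N -> (s j < s i)%N -> m i = 0 \/ m i = d (s i)).
Proof.
move=> [dS d0] mS; rewrite /preceq_r.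
have -> : gmx 1 d * (gmx s m)^-1 = (gmx s (fun i => m i - d (s i)))^-1.
  rewrite -[gmx 1 d]invrK -invrM ?unitrV ?gmx_unit // gmxV gmxM invg1 mulg1.
  by congr (_^-1); apply: eq_gmx => i; rewrite !perm1.
rewrite len_gmxV; last by rewrite sumrB mS sum_perm dS subrr.
rewrite !len_gmx // ((formlen_max 1 d).2 (conj erefl d0)) addnC.
by apply: formlen_shift => j i _ /lt_ord_neq0/d0.
Qed.

Lemma GinfW s m : \sum_i m i = 0 -> Ginf x (gmx s m).
Proof. by move=> m0; apply/GinfP; exists s, m. Qed.

Lemma balanced_diag d : diagexp d ->
  balanced x (gmx 1 d) <-> forall i k, i != ord0 -> k != ord0 -> d i = d k.
Proof.
move=> dd; have [dS d0] := dd; split=> [bal i k i0 k0|dE].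
  have [->//|ik] := eqVneq i k.
  (* Below the diagonal element on the left; on the right, row i, whose entry
     is in column k, would need exponent 0 or d k. *)
  pose m l : int := if l == i then d i else if l == ord0 then - d i else 0.
  have mS : \sum_l m l = 0.
    rewrite (bigD1 i) //= (bigD1 ord0) 1?eq_sym //= /m eqxx eq_sym (negPf i0) eqxx.
    by rewrite big1 ?addr0 ?subrr // => l /andP[/negPf-> /negPf->].
  have : Defs.interval x (gmx 1 d) (gmx (tperm i k) m).
    split; first exact: GinfW.
    apply/preceq_diag => // j l /lt_ord_neq0/negPf l0 _.
    by rewrite /m l0; case: eqP => [->|]; [right|left].
  rewrite bal => -[_ /preceq_r_diag-/(_ dd mS ord0 i)].
  rewrite tpermL tpermD // /m eqxx !lt0n.
  by case=> // di; move: (d0 i i0); rewrite di eqxx.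
apply/seteqP; split=> v [Gv vw]; split=> //;
  case/GinfP: Gv vw => s [m [-> mS]].
  move=> /(preceq_diag _ dd mS) mE; apply/preceq_r_diag => // j i ji sji.
  by rewrite (dE (s i) i) ?(lt_ord_neq0 ji) ?(lt_ord_neq0 sji) //; apply: mE ji sji.
move=> /(preceq_r_diag _ dd mS) mE; apply/preceq_diag => // j i ji sji.
by rewrite (dE i (s i)) ?(lt_ord_neq0 ji) ?(lt_ord_neq0 sji) //; apply: mE ji sji.
Qed.

(** * Powers of lambda, maximal length and the set Z' *)

Definition lamexp (k : int) (i : I) : int :=
  if i == ord0 then - (n.+1%:Z * k) else k.

Lemma sum_lamexp k : \sum_i lamexp k i = 0.
Proof.
rewrite big_ord_recl /lamexp eqxx /= sumr_const card_ord -mulr_natl natz.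
by rewrite addNr.
Qed.

Lemma lamexp_neq0 k i : i != ord0 -> lamexp k i = k.
Proof. by rewrite /lamexp => /negPf->. Qed.

Lemma lamX k : lam x n ^ k = gmx 1 (lamexp k).
Proof.
have lamE : lam x n = gmx 1 (lamexp 1).
  apply/matrixP => i j; rewrite !mxE perm1 /lamexp mulr1 (eq_sym j).
  by case: (i =P j) => // ->; case: ifP.
have lamXn (l : nat) : lam x n ^+ l = gmx 1 (lamexp l).
  elim: l => [|l IH].
    by rewrite expr0 -gmx1; apply: eq_gmx => i; rewrite /lamexp mulr0 oppr0 if_same.
  rewrite exprS IH lamE gmxM mulg1; apply: eq_gmx => i.
  by rewrite perm1 /lamexp; case: ifP; lia.
case: k => l; first exact: lamXn.
rewrite NegzE -exprnN lamXn gmxV invg1; apply: eq_gmx => i.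
by rewrite perm1 /lamexp; case: ifP; lia.
Qed.

Lemma lamexp_diag k : k != 0 -> diagexp (lamexp k).
Proof. by move=> k0; split=> [|i i0]; rewrite ?sum_lamexp ?lamexp_neq0. Qed.

(** The exponent in row 0 is determined by the zero sum. *)
Lemma lamexpP d : \sum_i d i = 0 ->
  (forall i k, i != ord0 -> k != ord0 -> d i = d k) -> d =1 lamexp (d ord_max).
Proof.
move=> dS dE; have max0 : ord_max != ord0 :> I by [].
have d1 i : i != ord0 -> d i = lamexp (d ord_max) i.
  by move=> i0; rewrite lamexp_neq0 //; apply: dE.
move=> i; have [->|/d1//] := eqVneq i ord0.
have : \sum_i d i = \sum_i lamexp (d ord_max) i by rewrite dS sum_lamexp.
by rewrite (bigD1 ord0) //= [RHS](bigD1 ord0) //= (eq_bigr _ d1) => /addIr.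
Qed.

Lemma maximal_lengthP s m : \sum_i m i = 0 ->
  maximal_length x (gmx s m) <-> s = 1%g /\ forall i, i != ord0 -> m i != 0.
Proof.
move=> mS; rewrite -formlen_max; split=> [mx|mmax v /GinfP[t [p [-> pS]]]].
  apply/eqP; rewrite eqn_leq formlen_le -(len_gmx s mS) /=.
  have [lS l0] : diagexp (lamexp 1) by exact: lamexp_diag.
  have <- : len x (gmx 1 (lamexp 1)) = formlen_bound n.+2.
    by rewrite len_gmx //; apply/formlen_max.
  exact/mx/GinfW.
by rewrite !len_gmx // mmax formlen_le.
Qed.

(** A nonzero entry [j, s j] above and to the left of [i, s i] would lie in the
    rectangle of any bubble whose rectangle contains [i, s i], without being its
    corner; when there is no such entry, [i, s i] is itself a bubble. *)
Lemma Zset'P s m (k : int) :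
  (forall j d : I, Zset' (gmx s m) (j, d) ->
     gmx s m j d = 0 \/ gmx s m j d = 1 \/ gmx s m j d = x ^ k) <->
  (forall j i, (j < i)%N -> (s j < s i)%N -> m i = 0 \/ m i = k).
Proof.
split=> [H j i ji sji|H j d nZ].
  have : Zset' (gmx s m) (i, s i).
    move=> [a [c [bub /= ia sic]]]; suff : gmx s m j (s j) = 0.
      by move/eqP; rewrite -[_ == _]negbK gmx_neq0 eqxx.
    apply: bub; last by lia.
      by move=> [ja _]; move: ji; rewrite ja ltnNge ia.
    by lia.
  move=> /H; rewrite gmxE => -[/eqP|[/xinf|/exprz_inj]]; [|by left|by right].
  by rewrite (negPf (expfz_neq0 _ x0)).
have [->|] := eqVneq (gmx s m j d) 0; first by left.
rewrite gmx_neq0 => /eqP ds; rewrite ds gmxE in nZ *; right.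
have [[i [ij sij]]|none] := pselect (exists i, (i < j)%N /\ (s i < s j)%N).
  by case: (H _ _ ij sij) => ->; [left|right].
case: nZ; exists j, (s j); split=> //= i c ic ij cj.
apply/eqP/negPn/negP; rewrite gmx_neq0 => /eqP ce; rewrite ce in ic cj.
have ij' : i != j by apply/eqP => e; apply: ic; rewrite e.
apply: none; exists i; split; rewrite ltn_neqAle ?ij ?cj andbT //.
by rewrite (inj_eq val_inj) (inj_eq perm_inj).
Qed.

End Monomial.

(** * Transcendence and the theorem *)

Lemma transcendental_neq0 (K L : fieldType) (iota : {rmorphism K -> L}) (x : L) :
  ~ algebraicOver iota x -> x != 0.
Proof.
move=> tr; apply/eqP => x0; apply: tr; exists 'X; first by rewrite polyX_eq0.
by rewrite map_polyX x0 rootX.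
Qed.

Lemma transcendental_exprz (K L : fieldType) (iota : {rmorphism K -> L}) (x : L) :
  ~ algebraicOver iota x -> forall k : int, x ^ k = 1 -> k = 0.
Proof.
move=> tr.
have pow (l : nat) : x ^+ l = 1 -> l = 0%N.
  case: l => // l xl; case: tr; exists ('X^(l.+1) - 1).
    by rewrite -size_poly_eq0 size_XnsubC.
  by rewrite rmorphB rmorph1 /= map_polyXn /root !hornerE xl subrr.
case=> l; first by move/pow->.
by rewrite NegzE -exprnN => /(canRL invrK); rewrite invr1 => /pow.
Qed.

Unset Implicit Arguments.

Theorem theorem4p19 (K L : fieldType) (iota : {rmorphism K -> L}) (x : L)
    (x_transcendental : ~ algebraicOver iota x) (n : nat) :
  (forall w : 'M[L]_n.+2,
     (Ginf x w /\ balanced x w /\ maximal_length x w) <->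
     (exists k : int, k <> 0 /\ w = lam x n ^ k)) /\
  (forall k : int, k <> 0 ->
   forall w : 'M[L]_n.+2, Ginf x w ->
     (preceq x w (lam x n ^ k) <->
      (forall j d : 'I_n.+2, Zset' w (j, d) ->
         w j d = 0 \/ w j d = 1 \/ w j d = x ^ k))).
Proof.
have x0 := transcendental_neq0 x_transcendental.
have xinf := transcendental_exprz x_transcendental.
split=> [w|k /eqP k0 w /(GinfP x0 xinf)[s [m [-> mS]]]].
  split=> [[/(GinfP x0 xinf)[s [m [-> mS]]] [bal mx]]|[k [/eqP k0 ->]]].
    have [s1 m0] := (maximal_lengthP x0 xinf s mS).1 mx; rewrite s1 in bal *.
    have mE := lamexpP mS ((balanced_diag x0 xinf (conj mS m0)).1 bal).
    exists (m ord_max); split; first by apply/eqP/m0.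
    by rewrite lamX //; apply: eq_gmx.
  have kd := lamexp_diag n k0; have [kS kn0] := kd.
  rewrite lamX //; split; first exact: GinfW.
  split; last exact/maximal_lengthP.
  by apply/balanced_diag => // i j i0 j0; rewrite !lamexp_neq0.
have kd := lamexp_diag n k0.
rewrite lamX // (preceq_diag x0 xinf s kd mS) (Zset'P x0 xinf).
by split=> H j i ji sji; have := H j i ji sji; rewrite lamexp_neq0 // (lt_ord_neq0 ji).
Qed.
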